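(* For every $n\in\mathbb{N}$, $$GM_n=(\lambda_1^{n}-\lambda_2^{n})+i(\lambda_1^{n-1}-\lambda_2^{n-1}),$$ where $\lambda_1=2$ and $\lambda_2=1$ are the roots of $\lambda^2-3\lambda+2=0$.
   Context: The Gaussian Mersenne sequence $(GM_k)_{k\ge 0}$ of complex numbers is defined by $GM_0=-\frac{i}{2}$, $GM_1=1$ and $GM_{k+2}=3GM_{k+1}-2GM_k$ for $k\ge 0$, where $i$ is the imaginary unit. $\mathbb{N}$ denotes the positive integers. *)

(* Defs.v *)
From mathcomp Require Export all_boot all_order all_algebra.
From mathcomp Require Export reals.
From mathcomp Require Export complex.

Set Implicit Arguments.
Unset Strict Implicit.
Unset Printing Implicit Defensive.

Import GRing.Theory Num.Theory.
Local Open Scope ring_scope.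

Fixpoint GM (R : realType) (n : nat) : R[i] :=
  match n with
  | 0 => - ('i / 2)
  | 1 => 1
  | (k.+1 as m).+1 => 3 * GM R m - 2 * GM R k
  end.

(* Main.v *)
Require Import Defs.
From mathcomp Require Import ring.

(** The sequence [GM] satisfies a linear recurrence with characteristic
    polynomial [z ^+ 2 - 3 * z + 2 = (z - 1) * (z - 2)], so every combination
    of the powers of [2] and [1] satisfies the same recurrence.  The closed
    form is such a combination, and a solution of a second-order recurrence is
    determined by two consecutive terms: it remains to compare the terms of
    index [1] and [2].  The comparison starts at index [1] because the exponent
    [n.-1] is truncated at [n = 0]; the initial value [GM R 0 = - ('i / 2)] is
    exactly what makes the term of index [2] equal to [3 + 'i]. *)

Import GRing.Theory Num.Theory.
Local Open Scope ring_scope.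

Lemma quadratic_roots_1_2 (F : idomainType) (z : F) :
  z ^+ 2 - 3 * z + 2 = 0 <-> z = 2 \/ z = 1.
Proof.
have -> : z ^+ 2 - 3 * z + 2 = (z - 2) * (z - 1) by ring.
split; last by case=> ->; rewrite subrr ?mul0r ?mulr0.
move/eqP; rewrite mulf_eq0 !subr_eq0.
by case/orP=> /eqP; [left | right].
Qed.

Lemma GM_rec (R : realType) (n : nat) :
  GM R n.+2 = 3 * GM R n.+1 - 2 * GM R n.
Proof. by []. Qed.

Lemma GM_2 (R : realType) : GM R 2 = 3 + 'i.
Proof.
rewrite GM_rec /= mulr1 mulrN opprK; congr (_ + _).
by rewrite mulrC divfK // pnatr_eq0.
Qed.

(** Shifting the index by one removes the truncated predecessor, so that the
    closed form obeys the recurrence for every [n]. *)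
Lemma GM_succ (R : realType) (n : nat) :
  GM R n.+1 = (2 ^+ n.+1 - 1) + 'i * (2 ^+ n - 1).
Proof.
(* Two consecutive terms are carried through the induction, since the
   recurrence has order two. *)
suff [] : GM R n.+1 = (2 ^+ n.+1 - 1) + 'i * (2 ^+ n - 1) /\
          GM R n.+2 = (2 ^+ n.+2 - 1) + 'i * (2 ^+ n.+1 - 1) by [].
elim: n => [|n [IH1 IH2]].
  by rewrite GM_2 /=; split; ring.
split=> //; rewrite GM_rec IH2 IH1 !exprS.
by ring.
Qed.

Theorem theorem3p1 (R : realType) :
  let lambda1 : R[i] := 2 in
  let lambda2 : R[i] := 1 in
  (forall z : R[i],
     z ^+ 2 - 3 * z + 2 = 0 <-> z = lambda1 \/ z = lambda2) /\
  (forall n : nat, (0 < n)%N ->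
     GM R n = (lambda1 ^+ n - lambda2 ^+ n)
              + 'i * (lambda1 ^+ n.-1 - lambda2 ^+ n.-1)).
Proof.
move=> lambda1 lambda2; split=> [z|[//|n] _]; first exact: quadratic_roots_1_2.
by rewrite GM_succ /lambda1 /lambda2 !expr1n.
Qed.
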